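(* Let $d\ge2$ and let $(\bar A_{k,n})_{k,n\ge1}$ be the negative $d$-Ostrowski array. Then: (1) each row satisfies $\bar A_{k,n+1}=-d\bar A_{k,n}+\bar A_{k,n-1}$ for all $n\ge2$; (2) each nonzero integer occurs exactly once among the entries $\bar A_{k,n}$, $k,n\ge1$; (3) for every sequence of integers $(B_n)$, not identically zero, satisfying $B_{n+1}=-dB_n+B_{n-1}$, there exists $k$ such that $(\bar A_{k,n})_n$ is tail equivalent to $(B_n)$ or to $(-B_n)$.
   Context: Define $(D_n)$ by $D_0=0$, $D_1=1$, $D_{n+1}=dD_n+D_{n-1}$. An Ostrowski word is a finite word $d_1\cdots d_i$ over $\{0,\dots,d\}$ with $0\le d_1<d$, $0\le d_j\le d$ for $j>1$, and $d_{j-1}=0$ whenever $d_j=d$; it represents $\sum_j d_jD_j$. Every non-negative integer has a unique Ostrowski word with nonzero last digit. An Ostrowski word is trimmed if its last digit is nonzero and it cannot be written as $0v$ with $v$ an Ostrowski word (equivalently, its first digit is nonzero, or its first two digits are $0$ and $d$). Let $w_1,w_2,\dots$ be the trimmed Ostrowski words listed in increasing order of the integers they represent, and $|w_m|$ the length of $w_m$. The $d$-Ostrowski array is $A_{m,n}=$ the integer represented by $0^{n-1}w_m$ ($m,n\ge1$); its rows satisfy $A_{m,n+1}=dA_{m,n}+A_{m,n-1}$ and are extended to all $n\in\mathbb Z$ by this recurrence. The negative $d$-Ostrowski array is $\bar A_{k,n}=A_{k,r_k-n}$ for $k\ge1$, $n\ge1$, where $r_k=1-|w_k|$. Two sequences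 $(X_n)$, $(Y_n)$ are tail equivalent if there is an integer $j$ with $X_n=Y_{n+j}$ for all sufficiently large $n$. *)

(* Defs.v *)
From Stdlib Require Import ClassicalEpsilon.
From mathcomp Require Import all_boot all_order all_algebra.
From mathcomp Require Import zify ring.
Set Implicit Arguments.
Unset Strict Implicit.
Unset Printing Implicit Defensive.
Import Order.TTheory GRing.Theory Num.Theory.

Fixpoint D (d n : nat) : nat :=
  match n with
  | 0 => 0
  | 1 => 1
  | (n''.+1 as n').+1 => d * D d n' + D d n''
  end.

(* The word d_1 ... d_i is the sequence [:: d_1; ...; d_i], so d_(j+1) is
   nth 0 u j.  The empty word is an Ostrowski word (for d > 0), of value 0. *)
Definition ostrowski (d : nat) (u : seq nat) : bool :=
  [&& head 0 u < d, all (fun a => a <= d) u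
    & sorted (fun a b => (b == d) ==> (a == 0)) u].

Definition word_value (d : nat) (u : seq nat) : nat :=
  \sum_(j < size u) nth 0 u j * D d j.+1.

Definition trimmed (d : nat) (u : seq nat) : Prop :=
  [/\ ostrowski d u, last 0 u != 0
    & ~ exists v : seq nat, ostrowski d v /\ u = 0 :: v].

(* w 1, w 2, ... lists the trimmed words by increasing value; w 0 is
   irrelevant.  Such a w exists by trimmed_listing_exists below, and its
   values at positive indices are determined by d. *)
Definition trimmed_listing (d : nat) (w : nat -> seq nat) : Prop :=
  [/\ forall m : nat, 0 < m -> trimmed d (w m),
      forall m n : nat, 0 < m -> m < n ->
        word_value d (w m) < word_value d (w n)
    & forall u : seq nat, trimmed d u -> exists2 m : nat, 0 < m & w m = u].

Local Open Scope ring_scope.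

Definition array_pos (d : nat) (w : nat -> seq nat) (m n : nat) : int :=
  (word_value d (nseq n.-1 0%N ++ w m))%:Z.

(* array_back d w m i = A_(m, 2 - i): the row is continued to the left by
   A_(m, n-1) = A_(m, n+1) - d A_(m, n), starting from A_(m,2), A_(m,1). *)
Fixpoint array_back (d : nat) (w : nat -> seq nat) (m i : nat) : int :=
  match i with
  | 0%N => array_pos d w m 2
  | 1%N => array_pos d w m 1
  | (i''.+1 as i').+1 => array_back d w m i'' - d%:Z * array_back d w m i'
  end.

(* Negz k is - (k + 1). *)
Definition ostrowski_array (d : nat) (w : nat -> seq nat) (m : nat) (n : int)
    : int :=
  match n with
  | Posz 0 => array_back d w m 2
  | Posz n' => array_pos d w m n'
  | Negz k => array_back d w m k.+3
  end.

Definition row_shift (w : nat -> seq nat) (k : nat) : int :=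
  1 - (size (w k))%:Z.

Definition neg_ostrowski_array (d : nat) (w : nat -> seq nat) (k : nat)
    (n : int) : int :=
  ostrowski_array d w k (row_shift w k - n).

(* Sequences indexed by n >= 1 are given by functions on int, whose values at
   n <= 0 do not matter here. *)
Definition tail_equivalent (X Y : int -> int) : Prop :=
  exists j N : int, forall n : int, N <= n -> X n = Y (n + j).

Lemma word_value_zeros d k u :
  word_value d (nseq k 0%N ++ u)
    = (\sum_(j < size u) nth 0 u j * D d (k + j).+1)%N.
Proof.
rewrite /word_value size_cat size_nseq big_split_ord /= big1 ?add0n.
  apply: eq_bigr => j _; rewrite nth_cat size_nseq ltnNge leq_addr /=.
  by rewrite addKn.
by move=> j _; rewrite nth_cat size_nseq ltn_ord nth_nseq ltn_ord mul0n.
Qed.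

Lemma ostrowski_array_rec d w m (n : int) :
  ostrowski_array d w m (n + 1)
    = d%:Z * ostrowski_array d w m n + ostrowski_array d w m (n - 1).
Proof.
have pos k : array_pos d w m k.+3
    = d%:Z * array_pos d w m k.+2 + array_pos d w m k.+1.
  rewrite /array_pos !word_value_zeros -PoszM -PoszD; congr Posz.
  rewrite big_distrr /= -big_split /=; apply: eq_bigr => j _.
  by rewrite mulnCA -mulnDr.
have back i : array_back d w m i
    = d%:Z * array_back d w m i.+1 + array_back d w m i.+2.
  by rewrite [array_back _ _ _ i.+2]/=; ring.
case: n => [[|[|n]]|[|[|n]]].
- exact: (back 1%N).
- exact: (back 0%N).
- by rewrite -PoszD addn1; exact: pos.
- exact: (back 2%N).
- exact: (back 3%N).
- have -> : Negz n.+2 + 1 = Negz n.+1 by lia.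
  have -> : Negz n.+2 - 1 = Negz n.+3 by lia.
  exact: back.
Qed.

Section ListingExists.
Local Open Scope nat_scope.
Variables (d : nat) (hd : 2 <= d).

Let D_rec n : D d n.+2 = d * D d n.+1 + D d n.
Proof. by []. Qed.

Let D_lt n : D d n < D d n.+1.
Proof.
elim: n => [//|n IH]; rewrite D_rec.
by have := leq_mul hd (leqnn (D d n.+1)); lia.
Qed.

Let D_ge n : n <= D d n.
Proof. by elim: n => [//|n IH]; exact: leq_ltn_trans IH (D_lt n). Qed.

Let D_mono m n : m <= n -> D d m <= D d n.
Proof.
by move=> /subnK <-; elim: (n - m) => [//|k IH];
  rewrite addSn (leq_trans IH) // ltnW.
Qed.

Let value_rcons u a :
  word_value d (rcons u a) = word_value d u + a * D d (size u).+1.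
Proof.
rewrite /word_value size_rcons big_ord_recr /= nth_rcons ltnn eqxx.
by congr (_ + _); apply: eq_bigr => j _; rewrite nth_rcons ltn_ord.
Qed.

Let ostrowski_rcons u a : ostrowski d (rcons u a) ->
  [/\ ostrowski d u, a <= d & a = d -> 0 < size u /\ last 0 u = 0].
Proof.
case/and3P; case: u => [|b u] /=.
  move=> h1 _ _; split; [|exact: ltnW|lia].
  by rewrite /ostrowski /=; lia.
move=> h1; rewrite all_rcons rcons_path => /and3P[h2 h3 h4] /andP[h5 /implyP h6].
split=> //; first by rewrite /ostrowski /= h1 h2 h4 h5.
by move=> /eqP/h6/eqP.
Qed.

Let value_lt u : ostrowski d u -> word_value d u < D d (size u).+1.
Proof.
have [n] := ubnP (size u); elim: n u => [//|n IH] u.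
case/lastP: u => [|u a]; first by rewrite /word_value big_ord0.
rewrite size_rcons value_rcons ltnS => hn /ostrowski_rcons[hu].
rewrite leq_eqVlt => /orP[/eqP ->|lt_ad] ha; last first.
  have := IH u hn hu; have := leq_mul lt_ad (leqnn (D d (size u).+1)).
  by rewrite D_rec; lia.
case: (ha erefl) => {ha}; case/lastP: u hn hu => [//|u b].
rewrite last_rcons size_rcons => hn /ostrowski_rcons[hu _ _] _ ->.
rewrite value_rcons mul0n addn0 (D_rec (size u).+1).
by have := IH u (ltnW hn) hu; lia.
Qed.

Let value_inj_size u v : size u = size v -> ostrowski d u -> ostrowski d v ->
  word_value d u = word_value d v -> u = v.
Proof.
elim/last_ind: u v => [|u a IH] v; first by case: v.
case/lastP: v => [|v b]; first by rewrite size_rcons.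
rewrite !size_rcons => -[es] /ostrowski_rcons[hu _ _] /ostrowski_rcons[hv _ _].
rewrite !value_rcons es => e.
have := value_lt hu; have := value_lt hv; rewrite es => lv lu.
have eab : a = b.
  have := congr1 (fun x => x %/ D d (size v).+1) e.
  by rewrite /= !(addnC (word_value _ _)) !divnMDl ?(leq_ltn_trans _ lv) //
    !divn_small // !addn0.
by rewrite (IH v) ?eab //; move: e; rewrite eab => /addIn.
Qed.

Let value_ge u : last 0 u != 0 -> D d (size u) <= word_value d u.
Proof.
case/lastP: u => [//|u a]; rewrite last_rcons value_rcons size_rcons.
by rewrite -lt0n => ha; have := leq_mul ha (leqnn (D d (size u).+1)); lia.
Qed.

Let value_inj u v : trimmed d u -> trimmed d v ->
  word_value d u = word_value d v -> u = v.
Proof.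
move=> [hu lu _] [hv lv _] e; apply: value_inj_size => //.
have := value_ge lu; have := value_ge lv.
have := value_lt hu; have := value_lt hv; rewrite e => a1 a2 a3 a4.
have [h|h|//] := ltngtP (size u) (size v).
  by have := D_mono h; lia.
by have := D_mono h; lia.
Qed.

Let P (N : nat) : Prop := exists u, trimmed d u /\ word_value d u = N.

Let P_unbounded N : exists M, N < M /\ P M.
Proof.
pose u := 1 :: rcons (nseq N 0) 1.
have tu : trimmed d u.
  split; first 2 last; [by case=> v [_]|..]; last by rewrite /= last_rcons.
  have d1 : (1 == d) = false by lia.
  have d0 : (0 == d) = false by lia.
  rewrite /ostrowski /= all_rcons all_nseq hd (ltnW hd) orbT /=.
  rewrite rcons_path d1 andbT; elim: N {u} => [//|n IH] /=.
  by rewrite d0 /=; case: n IH => [|n] //=; rewrite d0.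
exists (word_value d u); split; last by exists u.
have [_ lu _] := tu; have := value_ge lu; have := D_ge (size u).
by rewrite /= size_rcons size_nseq; lia.
Qed.

Let Pb N : bool := if excluded_middle_informative (P N) then true else false.

Let PbP N : reflect (P N) (Pb N).
Proof. by rewrite /Pb; case: excluded_middle_informative => h; constructor. Qed.

Let next_ex N : exists M, (N < M) && Pb M.
Proof.
by have [M [lt /PbP h]] := P_unbounded N; exists M; rewrite lt.
Qed.

Let f n := iter n (fun N => ex_minn (next_ex N)) 0.

Let f_lt n : f n < f n.+1.
Proof. by rewrite /f /=; case: ex_minnP => M /andP[]. Qed.

Let f_P n : P (f n.+1).
Proof. by rewrite /f /=; case: ex_minnP => M /andP[_ /PbP]. Qed.

Let f_min n M : f n < M -> P M -> f n.+1 <= M.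
Proof.
move=> lt /PbP h; rewrite /f /=; case: ex_minnP => K _; apply.
by rewrite [X in X < _]/(f n) lt.
Qed.

Let f_mono m n : m < n -> f m < f n.
Proof.
move=> /subnK <-; elim: (n - m.+1) => [|k IH]; first exact: f_lt.
by rewrite addSn (ltn_trans IH).
Qed.

Let f_surj N : 0 < N -> P N -> exists2 m, 0 < m & f m = N.
Proof.
move=> N0 PN; have : N <= f N.
  elim: {N0 PN} N => [//|n IH]; exact: leq_ltn_trans IH (f_lt n).
elim: {2}N => [|j IH]; first by rewrite leqNgt N0.
case: (leqP N (f j)) => [/IH //|lt le]; exists j.+1 => //.
by apply/eqP; rewrite eqn_leq le f_min.
Qed.

Lemma trimmed_listing_exists : exists w, trimmed_listing d w.
Proof.
pose w m := epsilon (inhabits [::])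
              (fun u => trimmed d u /\ word_value d u = f m).
have wP m : 0 < m -> trimmed d (w m) /\ word_value d (w m) = f m.
  case: m => // m _.
  exact: (epsilon_spec (inhabits [::])
            (fun u => trimmed d u /\ word_value d u = f m.+1) (f_P m)).
exists w; split=> [m /wP[]//|m n m0 lt|u tu].
  have [_ ->] := wP m m0; have [_ ->] := wP n (leq_ltn_trans (leq0n m) lt).
  exact: f_mono.
have u0 : 0 < word_value d u.
  have [_ lu _] := tu; apply: leq_trans (value_ge lu).
  by apply: leq_trans (D_ge _); case: (u) lu.
have [m m0 e] := f_surj u0 (ex_intro _ u (conj tu erefl)).
by exists m => //; have [tw ew] := wP m m0; apply: value_inj; rewrite ?ew.
Qed.

End ListingExists.

(* Main.v *)
Require Import Defs.
From mathcomp Require Import all_boot all_order all_algebra.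
From mathcomp Require Import zify ring.
Set Implicit Arguments.
Unset Strict Implicit.
Unset Printing Implicit Defensive.
Import Order.TTheory GRing.Theory Num.Theory.
Local Open Scope ring_scope.

(* Extending D to negative indices by D_(-p) = (-1)^(p+1) D_p, the entry
   bar A_(k,n+1) is the value of 0^n (reversal of w_k) in the base
   D_1, -D_2, D_3, ....  Reversals of Ostrowski words of length L represent
   exactly the D_(L+1) integers of an interval around 0, once each, since the
   choices of the last digits cut this interval into consecutive pieces; every
   word of nonzero value is a trimmed one surrounded by zeros, hence (2).

   For (3), let b satisfy the recurrence.  Then b_(t+1) D_M + b_t D_(M+1) is
   unchanged when t and M both grow by 1, so for M - t large it has a constant
   sign, which we make nonnegative by changing the sign of b; and it is smaller
   than D_M for t large.  If b_t = bar A_(k,n), the same expression with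
   bar A_(k,n+1) for b_(t+1) also lies in [0, D_M): it is a sum of digits times
   D_(M-p), essentially the value of an Ostrowski word of length < M.  The
   difference is a multiple of D_M, so b_(t+1) = bar A_(k,n+1). *)

(** * Growth and identities of the numbers D_n *)

Arguments D : simpl never.

Lemma D0 d : D d 0 = 0%N. Proof. by []. Qed.

Lemma D1 d : D d 1 = 1%N. Proof. by []. Qed.

Lemma DSS d n : D d n.+2 = (d * D d n.+1 + D d n)%N.
Proof. by []. Qed.

Lemma D_gt0 d n : (0 < d)%N -> (0 < D d n.+1)%N.
Proof.
move=> d0; elim: n => [//|n IH]; rewrite DSS.
by have := leq_mul d0 IH; lia.
Qed.

Lemma double_D_le d n : (2 <= d)%N -> (2 * D d n <= D d n.+1)%N.
Proof.
move=> hd; case: n => [//|n]; rewrite DSS.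
by have := leq_mul hd (leqnn (D d n.+1)); lia.
Qed.

Lemma D_addn_ge d m t : (2 <= d)%N -> (t.+1 * D d m.+1 <= D d (m + t.+1))%N.
Proof.
move=> hd; elim: t => [|t IH]; first by rewrite addn1 mul1n.
rewrite (addnS m t.+1); have := double_D_le (m + t.+1) hd.
have := leq_mul (ltn0Sn t) (leqnn (D d m.+1)); lia.
Qed.

Lemma D_ge d n : (2 <= d)%N -> (n <= D d n)%N.
Proof.
move=> hd; elim: n => [//|n IH]; have := double_D_le n hd.
by have := D_gt0 n (ltnW hd); lia.
Qed.

(** d'Ocagne's identity: one use of the recurrence in both products exchanges their roles, hence the
    sign. *)
Lemma D_ocagne d p m :
  (D d p.+1 * D d (m + p))%:Z - (D d p * D d (m + p).+1)%:Z
    = (-1) ^+ p * (D d m)%:Z :> int.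
Proof.
elim: p => [|p IH]; first by rewrite addn0 mul0n subr0 mul1n expr0 mul1r.
rewrite exprS -mulrA -IH addnS !DSS; lia.
Qed.

(** * Assembling and cutting Ostrowski words *)

(** A leading d in [v] forces [a] = 0, and the digit after that d is smaller than d because d is
    nonzero. So words grow at the front by a digit below d or by the block 0 d. *)
Lemma ostrowski_cons d a v : (0 < d)%N -> ostrowski d (a :: v) ->
  (a < d)%N /\ ostrowski d v \/
  exists v', [/\ a = 0%N, v = d :: v' & ostrowski d v'].
Proof.
rewrite /ostrowski /=; case: v => [|b v] /= d0.
  by move=> /and3P[-> _ _]; left; rewrite d0.
move=> /and3P[ha /and3P[_ hb hv]] /andP[hab hp].
have [e|nbd] := eqVneq b d; last by left; rewrite ha ltn_neqAle nbd hb hv hp.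
right; exists v; rewrite e; split=> //.
  by move: hab; rewrite e eqxx => /eqP.
case: v hv hp => [|c v] /=; first by rewrite d0.
move=> /andP[hc ->] /andP[hcb ->]; rewrite hc ltn_neqAle hc !andbT.
by apply/eqP => ec; move: hcb; rewrite ec e eqxx /=; lia.
Qed.

Lemma ostrowski_lt_cons d a v :
  (a < d)%N -> ostrowski d v -> ostrowski d (a :: v).
Proof.
move=> ha /and3P[hh hall hs]; apply/and3P; split=> //=.
  by rewrite hall (ltnW ha).
case: v hh hall hs => [//|b v] /= hb _ ->; rewrite andbT.
by have -> : (b == d) = false by lia.
Qed.

Lemma ostrowski_0d_cons d v :
  (0 < d)%N -> ostrowski d v -> ostrowski d [:: 0%N, d & v].
Proof.
move=> d0 /and3P[hh hall hs]; apply/and3P; split=> //=.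
  by rewrite hall leqnn.
rewrite eqxx implybT /=; case: v hh hall hs => [//|b v] /= hb _ ->.
by have -> : (b == d) = false by lia.
Qed.

Lemma ostrowski_zeros d n u :
  (0 < d)%N -> ostrowski d u -> ostrowski d (nseq n 0%N ++ u).
Proof. by move=> d0 hu; elim: n => [//|n IH]; apply: ostrowski_lt_cons. Qed.

Lemma ostrowski_cat d u v : (0 < d)%N -> ostrowski d (u ++ v) -> ostrowski d u.
Proof.
move=> d0 /and3P[hh hall /cat_sorted2[hs _]]; apply/and3P; split=> //.
  by case: u hh {hall hs}.
by move: hall; rewrite all_cat => /andP[].
Qed.

Lemma ostrowski_cat_zeros d u n :
  (0 < d)%N -> ostrowski d u -> ostrowski d (u ++ nseq n 0%N).
Proof.
move=> d0 /and3P[hh hall hs]; apply/and3P; split.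
- by case: u hh {hall hs} => //=; case: n.
- by rewrite all_cat hall all_nseq orbT.
- have d00 : (0%N == d) = false by lia.
  elim: n => [|n IH]; first by rewrite cats0.
  rewrite -addn1 nseqD catA cats1.
  by case: (u ++ _) IH => [//|b v] /=; rewrite rcons_path d00 andbT.
Qed.

(** * Reversed words and the intervals they fill *)

(* The value of the reversal of u in base D_1, -D_2, D_3, .... *)
Fixpoint nega_value (d : nat) (u : seq nat) : int :=
  if u is a :: v then
    nega_value d v + a%:Z * (-1) ^+ size v * (D d (size v).+1)%:Z
  else 0.

Lemma nega_value_zeros d n u : nega_value d (nseq n 0%N ++ u) = nega_value d u.
Proof. by elim: n => [//|n IH] /=; rewrite IH !mul0r addr0. Qed.

Lemma nega_value_cons d a v : nega_value d (a :: v) =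
  if odd (size v) then nega_value d v - (a * D d (size v).+1)%:Z
  else nega_value d v + (a * D d (size v).+1)%:Z.
Proof.
by rewrite /= -signr_odd PoszM; case: (odd _); rewrite ?expr0 ?expr1; ring.
Qed.

Arguments nega_value : simpl never.

(** An interval of D_(L+1) integers; the sign of D_L in the alternating base decides which side
    reaches farther. *)
Definition nega_range (d L : nat) (z : int) : bool :=
  if odd L then 1 - (D d L)%:Z <= z <= (D d L.+1)%:Z - (D d L)%:Z
  else (D d L)%:Z - (D d L.+1)%:Z + 1 <= z <= (D d L)%:Z.

Lemma ostrowski_ind d (P : seq nat -> Prop) : (0 < d)%N -> P [::] ->
  (forall a v, (a < d)%N -> ostrowski d v -> P v -> P (a :: v)) ->
  (forall v, ostrowski d v -> P v -> P [:: 0%N, d & v]) ->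
  forall u, ostrowski d u -> P u.
Proof.
move=> d0 P0 P1 P2 u; have [n] := ubnP (size u).
elim: n u => [//|n IH] [//|a v] /= hn /(ostrowski_cons d0).
case=> [[ha hv]|[v' [-> e hv]]]; first exact/P1/IH.
by subst v; apply/P2/IH => //; move: hn => /=; lia.
Qed.

Lemma nega_valueP d u : (0 < d)%N ->
  ostrowski d u -> nega_range d (size u) (nega_value d u).
Proof.
move=> d0; move: u; apply: (ostrowski_ind d0) => [|a v ha _|v _].
- by [].
- rewrite /nega_range nega_value_cons /= DSS => IH.
  have h : (a * D d (size v).+1 + D d (size v).+1 <= d * D d (size v).+1)%N.
    by rewrite addnC -mulSn leq_mul.
  by case: (odd _) IH => /=; lia.
- rewrite /nega_range !nega_value_cons /= !DSS.
  by case: (odd _) => /=; lia.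
Qed.

(** Changing a first digit below d moves the value by multiples of D_(L+1), exactly the number of
    values the L remaining digits can take. *)
Lemma nega_value_inj d u v : (0 < d)%N -> size u = size v ->
  ostrowski d u -> ostrowski d v -> nega_value d u = nega_value d v -> u = v.
Proof.
move=> d0 es hu; move: u hu v es.
(* The piece of the block 0 d lies just past that of the first digit 0, on the side away from the
   larger first digits. *)
have mix a u v : size u = (size v).+1 -> (a < d)%N -> ostrowski d u ->
    ostrowski d v -> nega_value d (a :: u) <> nega_value d [:: 0%N, d & v].
  move=> es ha hu hv; have := nega_valueP d0 hu; have := nega_valueP d0 hv.
  rewrite /nega_range !nega_value_cons es /= !DSS.
  have := leq_mul (leq0n a) (leqnn (D d (size v).+2)); rewrite DSS.
  by case: (odd _) => /=; lia.
apply: (ostrowski_ind d0) => [|a u ha hu IH|u hu IH] [|b v] // [es].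
- move=> /(ostrowski_cons d0)[[hb hv]|[v' [-> e hv]]] eq; last first.
    by subst v; case: (mix a u v').
  have eab : a = b.
    have := nega_valueP d0 hu; have := nega_valueP d0 hv.
    move: eq; rewrite /nega_range !nega_value_cons es.
    case: (ltngtP a b) => // h;
      have := leq_mul h (leqnn (D d (size v).+1));
      by case: (odd _) => /=; lia.
  by subst b; rewrite (IH v) //; move: eq; rewrite /nega_value /= es => /addIr.
- move=> /(ostrowski_cons d0)[[hb hv] /esym eq|[v' [-> e hv]] eq].
    by case: (mix b v u).
  subst v; case: es eq => es; rewrite /nega_value /= es => /addIr/addIr eq.
  by rewrite (IH v').
Qed.

Lemma nega_value_surj d L z : (2 <= d)%N -> nega_range d L z ->
  exists u, [/\ ostrowski d u, size u = L & nega_value d u = z].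
Proof.
move=> hd; have d0 : (0 < d)%N := ltnW hd.
have [n] := ubnP L; elim: n L z => [//|n IH] [|[|L]] z hn.
- rewrite /nega_range /= D0 D1 => hz.
  exists [::]; split=> //; first by rewrite /ostrowski /= d0.
  by rewrite /nega_value; lia.
- rewrite /nega_range /= DSS D0 D1 => hz.
  exists [:: `|z|%N]; split=> //.
    by apply: ostrowski_lt_cons; [lia|rewrite /ostrowski /= d0].
  rewrite nega_value_cons /= D1.
  by change (nega_value d [::]) with (0 : int); lia.
rewrite /nega_range => hz.
have T0 : 0 < (D d L.+2)%:Z by exact: D_gt0.
have big q : 0 <= q -> q < (d * D d L.+2)%:Z ->
    exists2 a, (a < d)%N & (a * D d L.+2)%:Z <= q < (a.+1 * D d L.+2)%:Z.
  move=> q0 ltq; exists `|(q %/ D d L.+2)%Z|%N.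
    have : (q %/ D d L.+2)%Z < d by rewrite ltz_divLR // -PoszM.
    by have : 0 <= (q %/ D d L.+2)%Z; [rewrite divz_ge0|lia].
  have q1 : 0 <= (q %/ D d L.+2)%Z by rewrite divz_ge0.
  have := divz_eq q (D d L.+2); have := ltz_pmod q T0.
  have := modz_ge0 q (lt0r_neq0 T0); move: (q %/ _)%Z (q %% _)%Z q1 => x y.
  by case: x => // x _; rewrite mulSn /=; lia.
(* The test decides whether [z] lies in the piece of the block 0 d. *)
have [h|h] := boolP (if odd L then z <= (D d L.+1)%:Z - (D d L.+2)%:Z
                     else (D d L.+2)%:Z - (D d L.+1)%:Z < z).
  case: (IH L (if odd L then z + (d * D d L.+1)%:Z
               else z - (d * D d L.+1)%:Z) (ltnW hn)) => [|u [hu <- eu]].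
    by move: h hz; rewrite /nega_range /= !DSS; case: (odd L) => /=; lia.
  exists [:: 0%N, d & u]; split=> //; first exact: ostrowski_0d_cons.
  rewrite !nega_value_cons eu /= mul0n; case: (odd _) => /=; lia.
(* The distance is taken from the end of the digit 0 piece that touches the 0 d piece; divided by
   the piece length [D d L.+2] it gives the first digit. *)
case: (big (if odd L then z + (D d L.+2)%:Z - (D d L.+1)%:Z - 1
          else (D d L.+2)%:Z - (D d L.+1)%:Z - z)) => [||a ha haq].
1,2: by move: h hz; rewrite /= !DSS; case: (odd L) => /=; lia.
case: (IH L.+1 (if odd L then z - (a * D d L.+2)%:Z
               else z + (a * D d L.+2)%:Z) hn) => [|u [hu su eu]].
  move: h hz haq; rewrite /nega_range /= mulSn.
  by case: (odd L) => /=; lia.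
exists (a :: u); split=> //=; rewrite ?su //.
  exact: ostrowski_lt_cons.
by rewrite nega_value_cons eu su /=; case: (odd L) => /=; lia.
Qed.

Lemma nega_range_ex d z : (2 <= d)%N -> exists L, nega_range d L z.
Proof.
(* Here D_L > |z|, and D_(L+1) >= 2 D_L puts all integers of absolute value below D_L in the
   interval. *)
move=> hd; set L := `|z|.+1%N; exists L; have d0 : (0 < d)%N := ltnW hd.
have := D_ge L hd; have := double_D_le L hd; have := D_gt0 L d0.
by rewrite /nega_range; case: (odd L); rewrite /L; lia.
Qed.

(** * Removing outer zeros: trimmed words *)

Lemma cat_zeros_inj u v m n : last 0%N u != 0%N -> last 0%N v != 0%N ->
  u ++ nseq m 0%N = v ++ nseq n 0%N -> u = v /\ m = n.
Proof.
move=> hu hv; elim: m n => [|m IH] [|n].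
- by rewrite !cats0.
- rewrite cats0 -addn1 nseqD catA cats1 => e; move: hu.
  by rewrite e last_rcons eqxx.
- rewrite cats0 -addn1 nseqD catA cats1 => e; move: hv.
  by rewrite -e last_rcons eqxx.
- rewrite -!(addn1 m) -(addn1 n) !nseqD !catA !cats1 => /rcons_inj[/IH[-> ->]].
  by split.
Qed.

Lemma zeros_cat_trimmed_inj d m n m' n' u v : (0 < d)%N ->
  trimmed d u -> trimmed d v ->
  nseq m 0%N ++ u ++ nseq n 0%N = nseq m' 0%N ++ v ++ nseq n' 0%N ->
  u = v /\ n = n'.
Proof.
move=> d0.
(* Otherwise [x] would be 0 followed by a prefix of an Ostrowski word, against trimmedness. *)
have lead k x y i j : trimmed d x -> trimmed d y ->
    x ++ nseq i 0%N = nseq k 0%N ++ y ++ nseq j 0%N -> k = 0%N.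
  case: k => [//|k] [ox lx nx] [oy _ _]; case: x lx ox nx => [//|a x] _ _ nx.
  move=> [ea ex]; case: nx; exists x; split; last by rewrite ea.
  apply: (ostrowski_cat (v := nseq i 0%N)) => //; rewrite ex.
  exact/ostrowski_zeros/ostrowski_cat_zeros.
elim: m m' => [|m IH] [|m'] tu tv e.
- by case: tu tv e => [_ lu _] [_ lv _]; apply: cat_zeros_inj.
- by have := lead m'.+1 _ _ _ _ tu tv e.
- by have := lead m.+1 _ _ _ _ tv tu (esym e).
- by apply: (IH m') => //; case: e.
Qed.

(** Zeros are dropped while an Ostrowski word remains, so a 0 that protects a digit d stays. *)
Lemma trim_leading d u : ostrowski d u -> last 0%N u != 0%N ->
  exists m v, trimmed d v /\ u = nseq m 0%N ++ v.
Proof.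
elim: u => [//|a u IH] hau la.
have [/andP[/eqP ea hu]|h] := boolP ((a == 0%N) && ostrowski d u).
  have lu : last 0%N u != 0%N by move: la; rewrite ea; case: (u).
  by have [m [v [tv ->]]] := IH hu lu; exists m.+1, v; rewrite ea.
exists 0%N, (a :: u); split=> //; split=> // -[v [hv [ea ev]]].
by move: h; rewrite ea ev hv eqxx.
Qed.

Lemma trim_trailing u : has (fun a => a != 0%N) u ->
  exists n v, last 0%N v != 0%N /\ u = v ++ nseq n 0%N.
Proof.
elim/last_ind: u => [//|u a IH]; rewrite has_rcons.
have [->|ha _] := eqVneq a 0%N; last first.
  by exists 0%N, (rcons u a); rewrite last_rcons ha cats0.
move=> /IH[n [v [lv ->]]]; exists n.+1, v; split=> //.
by rewrite -(addn1 n) nseqD catA cats1.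
Qed.

Lemma nega_value_nonzero d u : nega_value d u <> 0 ->
  has (fun a => a != 0%N) u.
Proof.
elim: u => [//|a u IH]; have [->|ha _] := eqVneq a 0%N; last by rewrite /= ha.
by rewrite (nega_value_zeros d 1 u) => /IH.
Qed.

Lemma trimmed_nega_value_ex d z : (2 <= d)%N -> z <> 0 ->
  exists u n, trimmed d u /\ nega_value d (u ++ nseq n 0%N) = z.
Proof.
move=> hd z0; have d0 : (0 < d)%N := ltnW hd.
have [L hL] := nega_range_ex z hd.
have [u [hu _ eu]] := nega_value_surj hd hL.
have [|n [v [lv e]]] := @trim_trailing u.
  by apply: (@nega_value_nonzero d); rewrite eu.
have hv : ostrowski d v.
  by apply: (ostrowski_cat (v := nseq n 0%N)) => //; rewrite -e.
have [m [x [tx ev]]] := trim_leading hv lv.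
exists x, n; split=> //; rewrite -eu e ev -catA.
by rewrite nega_value_zeros.
Qed.

Lemma trimmed_nega_value_inj d u v m n : (0 < d)%N ->
  trimmed d u -> trimmed d v ->
  nega_value d (u ++ nseq m 0%N) = nega_value d (v ++ nseq n 0%N) ->
  u = v /\ m = n.
Proof.
move=> d0 tu tv e; have [[hu _ _] [hv _ _]] := (tu, tv).
(* These leading zeros equalize the two lengths without changing the values. *)
apply: (@zeros_cat_trimmed_inj d (size v + n) m (size u + m) n) => //.
apply: (nega_value_inj d0); last by rewrite !nega_value_zeros.
- by rewrite !size_cat !size_nseq; lia.
- exact/ostrowski_zeros/ostrowski_cat_zeros.
- exact/ostrowski_zeros/ostrowski_cat_zeros.
Qed.

(** * Array entries as values of reversed words *)

Definition Dz (d : nat) (n : int) : int :=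
  match n with
  | Posz n' => (D d n')%:Z
  | Negz n' => (-1) ^+ n' * (D d n'.+1)%:Z
  end.

Lemma Dz_rec d n : Dz d (n + 1) = d%:Z * Dz d n + Dz d (n - 1).
Proof.
case: n => [[|n]|[|n]].
- have -> : 0%:Z - 1 = Negz 0 by lia.
  by rewrite add0r /= D0 D1; lia.
- have -> : n.+1%:Z + 1 = n.+2%:Z by lia.
  have -> : n.+1%:Z - 1 = n%:Z by lia.
  by rewrite /= DSS; lia.
- have -> : Negz 0 + 1 = 0%:Z by lia.
  have -> : Negz 0 - 1 = Negz 1 by lia.
  by rewrite /= DSS D0 D1; lia.
- have -> : Negz n.+1 + 1 = Negz n by lia.
  have -> : Negz n.+1 - 1 = Negz n.+2 by lia.
  by rewrite /= !exprS (DSS d n.+1) PoszD PoszM; ring.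
Qed.

Lemma int_rec_unique (a : int) (F G : int -> int) :
  (forall n, F (n + 1) = a * F n + F (n - 1)) ->
  (forall n, G (n + 1) = a * G n + G (n - 1)) ->
  F 1 = G 1 -> F 2 = G 2 -> forall n, F n = G n.
Proof.
move=> hF hG e1 e2.
have up (n : nat) : F n.+1%:Z = G n.+1%:Z /\ F n.+2%:Z = G n.+2%:Z.
  elim: n => [//|n [IH1 IH2]]; split=> //.
  have := hF n.+2%:Z; have := hG n.+2%:Z.
  have -> : n.+2%:Z + 1 = n.+3%:Z by lia.
  have -> : n.+2%:Z - 1 = n.+1%:Z by lia.
  by rewrite IH1 IH2 => -> ->.
have down (n : nat) :
    F (1 - n%:Z) = G (1 - n%:Z) /\ F (2 - n%:Z) = G (2 - n%:Z).
  elim: n => [|n [IH1 IH2]]; first by rewrite !subr0.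
  have -> : 2 - n.+1%:Z = 1 - n%:Z by lia.
  split=> //; have := hF (1 - n%:Z); have := hG (1 - n%:Z).
  have -> : 1 - n%:Z + 1 = 2 - n%:Z by lia.
  have -> : 1 - n%:Z - 1 = 1 - n.+1%:Z by lia.
  by rewrite IH1 IH2 => -> /addrI.
case=> [[|n]|n]; first by have [] := down 1%N.
  by have [] := up n.
have [+ _] := down n.+2.
by have -> : 1 - n.+2%:Z = Negz n by lia.
Qed.

(** Both sides obey the recurrence in [n] and agree at 1 and 2, where only positive indices of D
    occur. *)
Lemma ostrowski_arrayE d w m n : ostrowski_array d w m n
  = \sum_(j < size (w m)) (nth 0%N (w m) j)%:Z * Dz d (n + j%:Z).
Proof.
have pos k : array_pos d w m k.+1
    = \sum_(j < size (w m)) (nth 0%N (w m) j)%:Z * Dz d (k.+1%:Z + j%:Z).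
  rewrite /array_pos word_value_zeros (big_morph Posz PoszD (erefl 0%:Z)).
  by apply: eq_bigr => j _; rewrite PoszM -PoszD addSn.
move: n; apply: (@int_rec_unique d%:Z) => [n|n||].
- exact: ostrowski_array_rec.
- rewrite big_distrr -big_split /=; apply: eq_bigr => j _.
  have -> : n + 1 + j%:Z = n + j%:Z + 1 by ring.
  have -> : n - 1 + j%:Z = n + j%:Z - 1 by ring.
  by rewrite Dz_rec; ring.
- exact: (pos 0%N).
- exact: (pos 1%N).
Qed.

(** [row_shift] puts the last digit of [w k] at index -(n+1), so each digit meets D_(-p), with p its
    position from the end of the padded word. *)
Lemma neg_ostrowski_arrayE d w k n :
  neg_ostrowski_array d w k n.+1%:Z = nega_value d (w k ++ nseq n 0%N).
Proof.
rewrite /neg_ostrowski_array /row_shift ostrowski_arrayE.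
elim: (w k) => [|a u IH].
  by rewrite big_ord0 -[[::] ++ _]cats0 nega_value_zeros.
rewrite big_ord_recl /= [RHS]/nega_value /= -/(nega_value d _) -IH addrC.
congr (_ + _).
  apply: eq_bigr => j _; congr (_ * Dz d _).
  by case: j => j _ /=; rewrite /bump; lia.
rewrite -mulrA; congr (_ * _); rewrite size_cat size_nseq.
by have -> : 1 - (size u).+1%:Z - n.+1%:Z + 0 = Negz (size u + n) by lia.
Qed.

Lemma neg_ostrowski_array_rec d w k n :
  neg_ostrowski_array d w k (n + 1)
  = - d%:Z * neg_ostrowski_array d w k n + neg_ostrowski_array d w k (n - 1).
Proof.
rewrite /neg_ostrowski_array; set r := row_shift w k.
have := ostrowski_array_rec d w k (r - n).
have -> : r - n + 1 = r - (n - 1) by ring.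
have -> : r - n - 1 = r - (n + 1) by ring.
by move=> ->; ring.
Qed.

(** * Tails of solutions of the recurrence *)

(* sum_p f_p D_(M-p), where p is the position of a digit counted from the end
   of u. *)
Fixpoint mirror_value (d M : nat) (u : seq nat) : nat :=
  if u is a :: v then (mirror_value d M v + a * D d (M - (size v).+1))%N
  else 0%N.

(** For each digit, d'Ocagne's identity merges the two alternating terms into one term without
    sign. *)
Lemma nega_value_mirror d M u : (size u <= M)%N ->
  nega_value d (u ++ [:: 0%N]) * (D d M)%:Z + nega_value d u * (D d M.+1)%:Z
    = (mirror_value d M u)%:Z.
Proof.
elim: u => [|a v IH] hM.
  by rewrite /= /nega_value /=; lia.
have := D_ocagne d (size v).+1 (M - (size v).+1).
rewrite subnK // => e; rewrite /= PoszD -IH; last exact: ltnW.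
rewrite [nega_value d (_ :: _)]/nega_value /= -!/(nega_value d _).
rewrite [nega_value d (a :: v)]/nega_value /= -!/(nega_value d _).
rewrite size_cat addn1 PoszM.
have -> : (D d (M - (size v).+1))%:Z = (-1) ^+ (size v).+1 *
   ((D d (size v).+2 * D d M)%:Z - (D d (size v).+1 * D d M.+1)%:Z).
  by rewrite e mulrA -exprD addnn -signr_odd odd_double mul1r.
by rewrite !PoszM !exprS; ring.
Qed.

Lemma mirror_value_lt d M u : (0 < d)%N -> ostrowski d u -> (size u < M)%N ->
  (mirror_value d M u < D d M)%N.
Proof.
move=> d0 hu hM.
(* The extra term is the room for digits prepended later; the block 0 d uses it up exactly. *)
suff : (mirror_value d M u + D d (M - size u) <= D d M)%N.
  have := D_gt0 (M - size u).-1 d0.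
  by rewrite prednK ?subn_gt0 //; lia.
move: u hu hM; apply: (ostrowski_ind d0) => [|a v ha _ IH|v _ IH] hM.
- by rewrite /= subn0.
- have := IH (ltnW hM); move: hM => /=; rewrite -subn_gt0.
  case e : (M - (size v).+1)%N => [//|k] _.
  have -> : (M - size v = k.+2)%N by lia.
  have := leq_mul ha (leqnn (D d k.+1)).
  by rewrite DSS mulSn; lia.
- have := IH (ltnW (ltnW hM)); move: hM => /=; rewrite -subn_gt0 mul0n addn0.
  case e : (M - (size v).+2)%N => [//|k] _.
  have -> : (M - size v = k.+3)%N by lia.
  have -> : (M - (size v).+1 = k.+2)%N by lia.
  by rewrite DSS; lia.
Qed.

(** Two consecutive values of one weak sign fix the sign from there on. While strict signs
    alternate, |G_M| + |G_(M+1)| decreases, so this must stop. *)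
Lemma rec_eventually_signed (d : nat) (G : nat -> int) : (0 < d)%N ->
  (forall m, G m.+2 = d%:Z * G m.+1 + G m) ->
  exists M, (forall m, (M <= m)%N -> 0 <= G m) \/
            (forall m, (M <= m)%N -> G m <= 0).
Proof.
have pos (F : nat -> int) M : (forall m, F m.+2 = d%:Z * F m.+1 + F m) ->
    0 <= F M -> 0 <= F M.+1 -> forall m, (M <= m)%N -> 0 <= F m.
  move=> hF F0 F1 m /subnK <-.
  suff : 0 <= F (m - M + M)%N /\ 0 <= F (m - M + M).+1 by case.
  elim: (m - M)%N => [//|k [IH1 IH2]]; rewrite addSn hF; split=> //.
  by rewrite addr_ge0 // mulr_ge0.
move=> d0 hG.
have nG m : - G m.+2 = d%:Z * (- G m.+1) + - G m by rewrite hG; ring.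
suff [M [[h1 h2]|[h1 h2]]] : exists M, 0 <= G M /\ 0 <= G M.+1 \/
    G M <= 0 /\ G M.+1 <= 0.
- by exists M; left; apply: pos.
- exists M; right => m hm; rewrite -oppr_ge0.
  by apply: (pos (fun m => - G m) M) => //; rewrite oppr_ge0.
have [n] := ubnP (`|G 0%N| + `|G 1%N|)%N.
suff H M : (`|G M| + `|G M.+1| < n)%N -> exists M, 0 <= G M /\ 0 <= G M.+1 \/
    G M <= 0 /\ G M.+1 <= 0 by exact: H.
elim: n M => [//|n IH] M hM.
have [h|h] := boolP ((0 <= G M) && (0 <= G M.+1) ||
                      (G M <= 0) && (G M.+1 <= 0)).
  exists M; case/orP: h => /andP[]; tauto.
have [h'|h'] := boolP ((0 <= G M.+1) && (0 <= G M.+2) ||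
                        (G M.+1 <= 0) && (G M.+2 <= 0)).
  exists M.+1; case/orP: h' => /andP[]; tauto.
apply: (IH M.+1); move: h h' hM; rewrite hG.
case: d d0 {pos hG nG} => [//|d'] _.
have := mulr_ge0 (_ : 0 <= d'%:Z) (normr_ge0 (G M.+1)).
by case: (ger0P (G M.+1)) => hq /(_ isT); lia.
Qed.

Lemma trimmed_listing_tail d w (b : nat -> int) : (2 <= d)%N ->
  trimmed_listing d w ->
  (forall t, b t.+2 = - d%:Z * b t.+1 + b t) -> (exists t, b t <> 0) ->
  (exists M, forall m, (M <= m)%N ->
    0 <= b 1%N * (D d m)%:Z + b 0%N * (D d m.+1)%:Z) ->
  exists k n t, (1 <= k)%N /\
    forall i, neg_ostrowski_array d w k (n + i).+1%:Z = b (t + i)%N.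
Proof.
move=> hd [wt _ ws] hb [s0 bs0] [M0 hM0]; have d0 : (0 < d)%N := ltnW hd.
pose Z t := b t = 0 /\ b t.+1 = 0.
have ZS t : Z t <-> Z t.+1.
  rewrite /Z hb; split=> -[]; first by move=> -> ->; rewrite mulr0.
  by move=> ->; rewrite mulr0 add0r.
have nZ t : ~ Z t.
  have Z0 s : Z s <-> Z 0%N by elim: s => [//|s IH]; rewrite -ZS.
  by rewrite Z0 -(Z0 s0) => -[/bs0].
(* For t > K, b_1 D_m + b_0 D_(m+1) <= K D_(m+1) < t D_(m+1) <= D_(m+t). Either K+1 or K+2 serves as
   t, since two consecutive zeros would make b vanish. *)
pose K := (`|b 0%N| + `|b 1%N|)%N.
have [t htK bt] : exists2 t, (K < t)%N & b t <> 0.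
  case: (eqVneq (b K.+1) 0) => h1; last by exists K.+1 => //; apply/eqP.
  by exists K.+2 => // h2; apply: (nZ K.+1).
have [u [n [tu eu]]] := trimmed_nega_value_ex hd bt.
have [k k0 wk] := ws u tu; exists k, n, t; split=> //.
have inv s m : b s.+1 * (D d (m + s))%:Z + b s * (D d (m + s).+1)%:Z
    = b 1%N * (D d m)%:Z + b 0%N * (D d m.+1)%:Z.
  elim: s m => [|s IH] m; first by rewrite addn0.
  by rewrite -IH hb addnS DSS PoszD PoszM; ring.
set v := u ++ nseq n 0%N in eu.
have hv : ostrowski d v by case: tu => ou _ _; apply: ostrowski_cat_zeros.
(* Large enough both for the mirror bound on [v] and for the sign hypothesis. *)
pose m := (size v + M0)%N.
have lt_vM : (size v < m + t)%N by rewrite /m; lia.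
have eM := nega_value_mirror d (ltnW lt_vM).
have := mirror_value_lt d0 hv lt_vM.
have := inv t m; have := hM0 m (leq_addl _ _).
have : b 1%N * (D d m)%:Z + b 0%N * (D d m.+1)%:Z < (D d (m + t))%:Z.
  have := D_addn_ge m t.-1 hd; rewrite prednK; last by lia.
  have := leq_mul htK (leqnn (D d m.+1)); rewrite mulSn.
  have := D_gt0 m d0; have := double_D_le m hd.
  have le_norm (x y : int) : x * y <= `|x| * `|y| by rewrite -normrM ler_norm.
  have := le_norm (b 1%N) (D d m)%:Z; have := le_norm (b 0%N) (D d m.+1)%:Z.
  have := leq_mul (leqnn `|b 1%N|%N) (_ : D d m <= D d m.+1)%N.
  rewrite /K; lia.
move=> lt1 ge1 e1 lt2.
have step : nega_value d (v ++ [:: 0%N]) = b t.+1.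
  move: eM; rewrite eu => eM.
  have le_D (x : int) : 0 < x -> (D d (m + t))%:Z <= x * (D d (m + t))%:Z.
    by move=> x0; rewrite ler_peMl // -gtz0_ge1.
  have := le_D (nega_value d (v ++ [:: 0%N]) - b t.+1).
  have := le_D (b t.+1 - nega_value d (v ++ [:: 0%N])).
  case: (ltgtP (nega_value d (v ++ [:: 0%N])) (b t.+1)) => // h.
    by move=> /(_ _); lia.
  by move=> _ /(_ _); lia.
suff H i : neg_ostrowski_array d w k (n + i).+1%:Z = b (t + i)%N /\
    neg_ostrowski_array d w k (n + i).+2%:Z = b (t + i).+1.
  by move=> i; case: (H i).
elim: i => [|i [IH1 IH2]].
  rewrite !addn0 !neg_ostrowski_arrayE wk eu; split=> //.
  by rewrite -step -catA -[[:: 0%N]]/(nseq 1 0%N) -nseqD addn1.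
rewrite !addnS; split=> //; rewrite hb -IH2 -IH1.
have := neg_ostrowski_array_rec d w k (n + i).+2%:Z.
have -> : (n + i).+2%:Z + 1 = (n + i).+3%:Z by lia.
by have -> : (n + i).+2%:Z - 1 = (n + i).+1%:Z by lia.
Qed.

Theorem theorem3 (d : nat) (w : nat -> seq nat)
    (hd : (2 <= d)%N) (hw : trimmed_listing d w) :
  [/\ forall (k : nat) (n : int), (1 <= k)%N -> 2 <= n ->
        neg_ostrowski_array d w k (n + 1)
          = - d%:Z * neg_ostrowski_array d w k n
            + neg_ostrowski_array d w k (n - 1),
      forall z : int, z <> 0 ->
        exists! kn : nat * int,
          [/\ (1 <= kn.1)%N, 1 <= kn.2 & neg_ostrowski_array d w kn.1 kn.2 = z]
    & forall B : int -> int,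
        (exists n : int, 1 <= n /\ B n <> 0) ->
        (forall n : int, 2 <= n -> B (n + 1) = - d%:Z * B n + B (n - 1)) ->
        exists k : nat, (1 <= k)%N /\
          (tail_equivalent (neg_ostrowski_array d w k) B
           \/ tail_equivalent (neg_ostrowski_array d w k) (fun n => - B n))].
Proof.
have d0 : (0 < d)%N := ltnW hd; have [wt wlt ws] := hw.
split=> [k n _ _|z z0|B [n0 [n1 Bn0]] recB].
- exact: neg_ostrowski_array_rec.
- have [u [n [tu eu]]] := trimmed_nega_value_ex hd z0.
  have [k k0 wk] := ws u tu.
  exists (k, n.+1%:Z); split=> [|[k' n'] /=].
    by split=> //; rewrite neg_ostrowski_arrayE wk.
  case: n' => [[|n']|n'] [k'0 n'1 e'] //.
  move: e'; rewrite neg_ostrowski_arrayE -eu => e'.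
  have [ew en] := trimmed_nega_value_inj d0 (wt _ k'0) tu e'.
  rewrite en; congr (_, _); move: ew; rewrite -wk => ew.
  by case: (ltngtP k k') => // h; [have := wlt _ _ k0 h|have := wlt _ _ k'0 h];
    rewrite ew ltnn.
(* [B] is constrained only from index 1 on, hence the shift. *)
pose b t := B t.+1%:Z.
have hb t : b t.+2 = - d%:Z * b t.+1 + b t.
  rewrite /b; have := recB t.+2%:Z isT.
  have -> : t.+2%:Z + 1 = t.+3%:Z by lia.
  by have -> : t.+2%:Z - 1 = t.+1%:Z by lia.
have hnz : exists t, b t <> 0.
  by exists `|n0 - 1|%N; rewrite /b; have -> : `|n0 - 1|%N.+1%:Z = n0 by lia.
have tailP (C : int -> int) k n t :
    (forall i, neg_ostrowski_array d w k (n + i).+1%:Z = C (t + i)%N.+1%:Z) ->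
    tail_equivalent (neg_ostrowski_array d w k) C.
  move=> h; exists (t%:Z - n%:Z), n.+1%:Z => x hx.
  have := h `|x - n.+1%:Z|%N.
  have -> : (n + `|x - n.+1%:Z|).+1%:Z = x by lia.
  by have -> : (t + `|x - n.+1%:Z|).+1%:Z = x + (t%:Z - n%:Z) by lia.
(* This expression obeys the recurrence of D in m; its eventual sign selects [B] or its negative. *)
have [|M [hM|hM]] := @rec_eventually_signed d
    (fun m => b 1%N * (D d m)%:Z + b 0%N * (D d m.+1)%:Z) d0.
- by move=> m; rewrite !DSS !PoszD !PoszM; ring.
- have [|k [n [t [k1 h]]]] := trimmed_listing_tail hd hw hb hnz.
    by exists M.
  by exists k; split=> //; left; apply: tailP h.
- have [|||k [n [t [k1 h]]]] :=
    @trimmed_listing_tail d w (fun t => - b t) hd hw.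
  + by move=> t; rewrite hb; ring.
  + by have [t ht] := hnz; exists t => /eqP; rewrite oppr_eq0 => /eqP.
  + exists M => m /hM; rewrite -oppr_ge0; lia.
  by exists k; split=> //; right; apply: (tailP (fun x => - B x)) h.
Qed.
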